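(* For every positive integer $n\neq 5$, the maximum number of edges in an $n$-vertex graph containing no subgraph isomorphic to $T$ is $$\mathrm{ex}(n,T)=\begin{cases}\left\lfloor \frac{n^2}{4}\right\rfloor+\left\lfloor\frac n2\right\rfloor, & n\not\equiv 2 \pmod 4,\\[2pt] \frac{n^2}{4}+\frac n2-1, & n\equiv 2\pmod 4.\end{cases}$$
   Context: All graphs are finite, simple and undirected. $T$ (the flattened tetrahedron) is the graph on six vertices $a,b,c,d,e,f$ with the nine edges $bc, ce, eb, ab, ac, bd, de, cf, fe$; i.e. a triangle $bce$ with a further triangle erected on each of its three edges. $\mathrm{ex}(n,H)$ is the maximum number of edges in an $n$-vertex graph not containing $H$ as a subgraph. *)

(* Defs.v *)
From mathcomp Require Import all_boot.

Set Implicit Arguments.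
Unset Strict Implicit.
Unset Printing Implicit Defensive.

(* A graph on the vertex set V is given by its set of edges, an edge being a
   set of exactly two vertices; hence no loops and no multiple edges. *)
Definition simple_graph (V : finType) (E : {set {set V}}) : bool :=
  [forall e in E, #|e| == 2].

(* Since f is injective, the edges f @: e form a graph isomorphic to H; the
   copy need not be induced. *)
Definition contains_copy (V W : finType)
    (E : {set {set V}}) (H : {set {set W}}) : bool :=
  [exists f : {ffun W -> V},
     injectiveb f && ([set f @: (e : {set W}) | e in H] \subset E)].

(* If no simple graph on n vertices avoids H, which only happens for edgeless
   H, the maximum ranges over the empty set and is 0. *)
Definition extremal_number (n : nat) (W : finType) (H : {set {set W}}) : nat :=
  \max_(E : {set {set 'I_n}} | simple_graph E && ~~ contains_copy E H) #|E|.

Definition flattened_tetrahedron : {set {set 'I_6}} :=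
  let a := @Ordinal 6 0 isT in let b := @Ordinal 6 1 isT in
  let c := @Ordinal 6 2 isT in let d := @Ordinal 6 3 isT in
  let e := @Ordinal 6 4 isT in let f := @Ordinal 6 5 isT in
  [set:: [:: [set b; c]; [set c; e]; [set e; b];
             [set a; b]; [set a; c]; [set b; d];
             [set d; e]; [set c; f]; [set f; e]]].

(* Main.v *)
(* Upper bound, by strong induction on the number n of vertices, for a graph with more edges than
   claimed. If n = 0 or 3 (mod 4), averaging over vertex deletions contradicts the bound for n - 1.
   Otherwise the bound for n - 1 makes all degrees exceed n / 2. A K_5 minus an edge is then
   impossible, because an outside vertex sees at most one of four of its vertices; so every vertex
   outside a K_4 sees at most two of its vertices, and deleting a K_4 contradicts the bound for
   n - 4 (for n = 9, where ex(5) is exceptional, the remaining five vertices span a K_5 minus an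
   edge). In a K_4-free graph the apexes over the three sides of a triangle are distinct, so each
   triangle has a light side, i.e. one lying in a single triangle; degrees exclude this for
   n = 2 (mod 4). For n = 2 m - 1, a light edge u v with apex w partitions the vertices other than
   w into neighbours of u and of v; the bound for n - 3 gives w degree at least m + 2, so all edges
   inside N(w) are light, which leaves only a star forest inside each of the two parts and
   altogether too few edges.
   For n = 6 the statement is a finite computation. *)
Require Import Defs.
From mathcomp Require Import all_boot zify.

Set Implicit Arguments.
Unset Strict Implicit.
Unset Printing Implicit Defensive.

(** * The claimed value and its closed forms modulo 4 *)

Definition turan_value n :=
  if n %% 4 == 2 then n ^ 2 %/ 4 + n %/ 2 - 1 else n ^ 2 %/ 4 + n %/ 2.

Lemma turan_value4D0 k : turan_value (4 * k) = 4 * k * k + 2 * k.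
Proof.
rewrite /turan_value; have -> : (4 * k) ^ 2 = (4 * k * k) * 4 by lia.
by rewrite mulnK //; case: eqP => ?; lia.
Qed.

Lemma turan_value4D1 k : turan_value (4 * k + 1) = 4 * k * k + 4 * k.
Proof.
rewrite /turan_value; have -> : (4 * k + 1) ^ 2 = (4 * k * k + 2 * k) * 4 + 1 by lia.
by rewrite divnMDl //; case: eqP => ?; lia.
Qed.

Lemma turan_value4D2 k : turan_value (4 * k + 2) = 4 * k * k + 6 * k + 1.
Proof.
rewrite /turan_value; have -> : (4 * k + 2) ^ 2 = (4 * k * k + 4 * k + 1) * 4 by lia.
by rewrite mulnK //; case: eqP => ?; lia.
Qed.

Lemma turan_value4D3 k : turan_value (4 * k + 3) = 4 * k * k + 8 * k + 3.
Proof.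
rewrite /turan_value; have -> : (4 * k + 3) ^ 2 = (4 * k * k + 6 * k + 2) * 4 + 1 by lia.
by rewrite divnMDl //; case: eqP => ?; lia.
Qed.

Definition turan_valueE :=
  (turan_value4D0, turan_value4D1, turan_value4D2, turan_value4D3).

(** The increment is what a K_4 adds when each of the other [n] vertices sends it two edges. *)
Lemma turan_valueD4 n : turan_value (n + 4) = turan_value n + 2 * n + 6.
Proof.
rewrite (divn_eq n 4) (mulnC _ 4); set k := n %/ 4.
have -> : 4 * k + n %% 4 + 4 = 4 * k.+1 + n %% 4 by lia.
have : n %% 4 < 4 by rewrite ltn_mod.
by case: (n %% 4) => [|[|[|[|]]]] // _; rewrite ?addn0 !turan_valueE; lia.
Qed.

Lemma sum_bool_card (V : finType) (S : {set V}) (P : pred V) :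
  \sum_(x in S) P x = #|[set x in S | P x]|.
Proof.
rewrite -sum1_card big_mkcond [RHS]big_mkcond /=; apply: eq_bigr => x _.
by rewrite inE; case: (x \in S); case: (P x).
Qed.

Lemma sum_leq_const (V : finType) (S : {set V}) (F : V -> nat) c :
  (forall x, x \in S -> F x <= c) -> \sum_(x in S) F x <= #|S| * c.
Proof. by move=> leFc; rewrite -sum_nat_const; apply: leq_sum. Qed.

(** * Exhaustive search over small graphs *)

Fixpoint upper_triangle (V : Type) (r : rel V) (s : seq V) : seq bool :=
  if s is x :: s' then map (r x) s' ++ upper_triangle r s' else [::].

(** For [i < j], the position of entry (i, j) when the part of a [k] by [k] matrix above the
    diagonal is read row by row. *)
Fixpoint triangle_index k i j :=
  match i, j with
  | 0, j'.+1 => j'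
  | i'.+1, j'.+1 => k.-1 + triangle_index k.-1 i' j'
  | _, _ => 0
  end.

Definition bits_adj k (bits : seq bool) i j :=
  (i != j) && nth false bits (triangle_index k (minn i j) (maxn i j)).

(** The predicate is passed down as a continuation, so the 2^n sequences are never listed. *)
Fixpoint all_bits n (P : seq bool -> bool) :=
  if n is n'.+1 then
    all_bits n' (fun bits => P (true :: bits)) &&
    all_bits n' (fun bits => P (false :: bits))
  else P [::].

(* [bits] ranges over the upper triangles of adjacency matrices of graphs on [k] vertices.
   [find] and [if] rather than [has] and [==>], which call-by-value evaluation
   would not cut short. *)
Definition forces k t (ps : seq (nat * nat)) :=
  let perms := permutations (iota 0 k) in
  all_bits 'C(k, 2) (fun bits => if t <= count id bits then
    find (fun p => all (fun ij => bits_adj k bits (nth 0 p ij.1) (nth 0 p ij.2)) ps)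
      perms < size perms else true).

(** A triangle 0, 1, 2 and two vertices 3, 4 joined to all of it; 3, 4 is the missing pair. *)
Definition K5minus_edges :=
  [:: (0, 1); (0, 2); (1, 2); (0, 3); (1, 3); (2, 3); (0, 4); (1, 4); (2, 4)].

(* The vertices are listed in the order b, c, e, a, d, f. *)
Definition T_edges :=
  [:: (0, 1); (1, 2); (0, 2); (3, 0); (3, 1); (4, 0); (4, 2); (5, 1); (5, 2)].

Lemma forces_K5minus : forces 5 9 K5minus_edges.
Proof. by vm_compute. Qed.

(** The threshold is one more than [turan_value 6]. *)
Lemma forces_T : forces 6 12 T_edges.
Proof. by vm_compute. Qed.

Lemma all_bitsP n P bits : all_bits n P -> size bits = n -> P bits.
Proof.
elim: n P bits => [|n IHn] P [|b bits] //= /andP[Pt Pf] [sz].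
by case: b; [apply: (IHn _ _ Pt) | apply: (IHn _ _ Pf)].
Qed.

Lemma size_upper_triangle (V : Type) (r : rel V) s :
  size (upper_triangle r s) = 'C(size s, 2).
Proof. by elim: s => //= x s IHs; rewrite size_cat size_map IHs binS bin1 addnC. Qed.

Lemma nth_upper_triangle (V : Type) (r : rel V) x0 s i j : i < j < size s ->
  nth false (upper_triangle r s) (triangle_index (size s) i j) =
    r (nth x0 s i) (nth x0 s j).
Proof.
elim: s i j => [|x s IHs] [|i] [|j] //=; first by rewrite andbF.
  by rewrite ltnS => js; rewrite nth_cat size_map js (nth_map x0).
rewrite !ltnS => ij; rewrite nth_cat size_map ltnNge leq_addr /=.
by rewrite addKn IHs.
Qed.

(** The conclusion lists the six non-edges of T; the ends of its nine edges are distinct anyway once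
    [r] is irreflexive. The apexes are [a] over b c, [d] over b e and [f] over c e. *)
Definition T_free (V : finType) (r : rel V) := forall b c e a d f : V,
  r b c -> r c e -> r b e -> r a b -> r a c -> r d b -> r d e -> r f c -> r f e ->
  [|| a == e, d == c, f == b, a == d, a == f | d == f].

(** * Degrees, codegrees and edge counts *)

Section Graph.

Variables (V : finType) (r : rel V).
Hypotheses (r_sym : symmetric r) (r_irr : irreflexive r).

Implicit Types (S A B : {set V}) (x y z : V).

Definition deg S x := \sum_(y in S) r x y.
Definition codeg S x y := \sum_(z in S) (r x z && r y z).
(* Counts ordered pairs, so [edges S S] is twice the number of edges inside [S]. *)
Definition edges A B := \sum_(x in A) deg B x.

Lemma adj_neq x y : r x y -> x != y.
Proof. by apply: contraTneq => ->; rewrite r_irr. Qed.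

Lemma codegC S x y : codeg S x y = codeg S y x.
Proof. by apply: eq_bigr => z _; rewrite andbC. Qed.

Lemma edgesC A B : edges A B = edges B A.
Proof.
rewrite /edges /deg exchange_big /=.
by apply: eq_bigr => x _; apply: eq_bigr => y _; rewrite r_sym.
Qed.

Lemma degD1 S x y : y \in S -> deg S x = r x y + deg (S :\ y) x.
Proof. by move=> yS; rewrite /deg (big_setD1 y). Qed.

Lemma degD1_self S x : deg (S :\ x) x = deg S x.
Proof.
case: (boolP (x \in S)) => [xS|xNS]; first by rewrite (degD1 x xS) r_irr.
by rewrite (setDidPl _) // disjoint_sym disjoints1.
Qed.

Lemma degID S A x : A \subset S -> deg S x = deg A x + deg (S :\: A) x.
Proof. by move=> AS; rewrite /deg (big_setID A) /= (setIidPr AS). Qed.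

Lemma deg_leq_card S x : deg S x <= #|S|.
Proof. by rewrite /deg sum_bool_card subset_leq_card //; apply/subsetP => y /setIdP[]. Qed.

Lemma edgesID S A : A \subset S ->
  edges S S = edges A A + edges (S :\: A) (S :\: A)
                      + 2 * edges A (S :\: A).
Proof.
move=> AS; rewrite {1}/edges (big_setID A) /= (setIidPr AS).
under eq_bigr do rewrite (degID _ AS).
under [X in _ + X]eq_bigr do rewrite (degID _ AS).
rewrite !big_split /= -!/(edges _ _) (edgesC _ A); lia.
Qed.

Lemma edgesD1 S x : x \in S ->
  edges S S = edges (S :\ x) (S :\ x) + 2 * deg S x.
Proof.
move=> xS; rewrite (@edgesID S [set x]) ?sub1set //.
by rewrite /edges !big_set1 degD1_self /deg big_set1 r_irr.
Qed.

Lemma edges_leq S : edges S S <= #|S| * #|S|.-1.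
Proof.
apply: sum_leq_const => x xS.
by rewrite -degD1_self (cardsD1 x S) xS; apply: deg_leq_card.
Qed.

Lemma deg_codeg S x y : deg S x + deg S y <= #|S| + codeg S x y.
Proof.
rewrite -sum1_card -!big_split /=; apply: leq_sum => z _.
by case: (r x z); case: (r y z).
Qed.

Lemma sum_deg_leq A (s : seq V) c :
  (forall y, y \in A -> count (r y) s <= c) -> \sum_(p <- s) deg A p <= #|A| * c.
Proof.
move=> le_c; rewrite /deg exchange_big; apply: sum_leq_const => y yA /=.
apply: leq_trans (le_c y yA); rewrite -sum1_count [leqRHS]big_mkcond /=.
by apply: leq_sum => p _; rewrite r_sym; case: (r y p).
Qed.

Lemma sum_upper_triangle (s : seq V) :
  \sum_(x <- s) \sum_(y <- s) r x y = 2 * count id (upper_triangle r s).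
Proof.
elim: s => [|x s IHs] /=; first by rewrite big_nil.
rewrite big_cons big_cons r_irr add0n.
under [X in _ + X]eq_bigr do rewrite big_cons r_sym.
rewrite big_split /= IHs count_cat mulnDr addnA addnn mul2n; congr (_ + _).
rewrite -mul2n; congr (2 * _).
by rewrite count_map -sum1_count [RHS]big_mkcond; apply: eq_bigr => y _ /=; case: (r x y).
Qed.

(** The slack [.+1] is harmless because [edges S S] is even, being twice the number of ones in the
    upper triangle along [enum S]. The permutation found by the search lists the copy. *)
Lemma forces_subgraph k t ps S x0 :
  forces k t ps -> all (fun ij => (ij.1 < k) && (ij.2 < k)) ps ->
  #|S| = k -> 2 * t <= (edges S S).+1 ->
  exists s : seq V, [/\ size s = k, uniq s, {subset s <= S}
    & all (fun ij => r (nth x0 s ij.1) (nth x0 s ij.2)) ps].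
Proof.
move=> forced ps_lt cS dense.
pose e := enum S; have sz_e : size e = k by rewrite -cardE.
have edgesE : edges S S = 2 * count id (upper_triangle r e).
  rewrite -sum_upper_triangle big_enum; apply: eq_bigr => x _.
  by rewrite big_enum.
have size_bits : size (upper_triangle r e) = 'C(k, 2) by rewrite size_upper_triangle sz_e.
have := all_bitsP forced size_bits.
have -> /= : t <= count id (upper_triangle r e) by move: dense; rewrite edgesE; clear; lia.
rewrite -has_find => /hasP[p]; rewrite mem_permutations => perm_p adj_p.
have sz_p : size p = k by rewrite (perm_size perm_p) size_iota.
have p_lt i : i \in p -> i < size e by rewrite (perm_mem perm_p) mem_iota sz_e.
exists (map (nth x0 e) p); split.
- by rewrite size_map.
- rewrite map_inj_in_uniq ?(perm_uniq perm_p) ?iota_uniq // => i j ip jp /eqP.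
  by rewrite nth_uniq ?enum_uniq ?p_lt // => /eqP.
- by move=> _ /mapP[i ip ->]; rewrite -mem_enum mem_nth ?p_lt.
apply/allP => -[i j] ijps /=; have /= /andP[ik jk] := allP ps_lt _ ijps.
rewrite !(nth_map 0) ?sz_p //; have /= := allP adj_p _ ijps.
have pik : nth 0 p i \in p by rewrite mem_nth ?sz_p.
have pjk : nth 0 p j \in p by rewrite mem_nth ?sz_p.
move: (nth 0 p i) (nth 0 p j) pik pjk => a b /p_lt al /p_lt bl.
rewrite /bits_adj -sz_e; case: ltngtP => // ab /=.
  by rewrite (nth_upper_triangle _ x0) ?ab.
by rewrite (nth_upper_triangle _ x0) ?ab // r_sym.
Qed.

(** * Excluding K_5 minus an edge and K_4; the case of six vertices *)

Hypothesis r_free : T_free r.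

(* [q] and [x] need not be adjacent: nine edges of [K_5] suffice. *)
Lemma K5minus_free S p1 p2 p3 q x :
  9 <= #|S| -> (forall y, y \in S -> #|S| < 2 * deg S y) ->
  {subset [:: p1; p2; p3; q; x] <= S} -> q != x ->
  [&& r p1 p2, r p1 p3 & r p2 p3] -> [&& r p1 q, r p2 q & r p3 q] ->
  ~~ [&& r p1 x, r p2 x & r p3 x].
Proof.
move=> S9 degS WS qx /and3P[r12 r13 r23] /and3P[r1q r2q r3q].
apply/negP => /and3P[r1x r2x r3x].
pose W := [set p1; p2; p3; q; x]; pose Y := S :\: W.
have sWS : W \subset S.
  apply/subsetP => y yW; apply: WS; move: yW.
  by rewrite !inE -!orbA.
have xq : x != q by rewrite eq_sym.
have neqs := (adj_neq r12, adj_neq r13, adj_neq r23, adj_neq r1q, adj_neq r2q,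
  adj_neq r3q, adj_neq r1x, adj_neq r2x, adj_neq r3x, qx).
have adj := (r12, r13, r23, r1q, r2q, r3q, r1x, r2x, r3x).
have adj' := (etrans (r_sym _ _) r12, etrans (r_sym _ _) r13, etrans (r_sym _ _) r23,
  etrans (r_sym _ _) r1q, etrans (r_sym _ _) r2q, etrans (r_sym _ _) r3q,
  etrans (r_sym _ _) r1x, etrans (r_sym _ _) r2x, etrans (r_sym _ _) r3x).
have neqs' := (neqs, adj_neq adj'.1.1.1.1.1.1.1.1, adj_neq adj'.1.1.1.1.1.1.1.2,
  adj_neq adj'.1.1.1.1.1.1.2, adj_neq adj'.1.1.1.1.1.2, adj_neq adj'.1.1.1.1.2,
  adj_neq adj'.1.1.1.2, adj_neq adj'.1.1.2, adj_neq adj'.1.2, adj_neq adj'.2, xq).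
have cW : #|W| = 5.
  rewrite /W -!setUA !cardsU1 cards1 !inE.
  by rewrite !negb_or !neqs.
have cY : #|Y| + 5 = #|S| by rewrite cardsD (setIidPr sWS) cW subnK // -cW subset_leq_card.
have degW y : deg W y = r y p1 + r y p2 + r y p3 + r y q + r y x.
  rewrite /deg /W -!setUA !big_setU1 ?big_set1 ?inE ?negb_or ?neqs //=.
  by rewrite !addnA.
have S1 : p1 \in S by apply: WS; rewrite !inE eqxx.
have S2 : p2 \in S by apply: WS; rewrite !inE eqxx ?orbT.
have S3 : p3 \in S by apply: WS; rewrite !inE eqxx ?orbT.
have Sq : q \in S by apply: WS; rewrite !inE eqxx ?orbT.
have Sx : x \in S by apply: WS; rewrite !inE eqxx ?orbT.
(* Otherwise a b c is the central triangle of a T with apexes [y] over a b, [d] over a c and [e]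
   over b c. *)
have apex_free a b c d e y : y \in Y ->
    [&& r a b, r a c & r b c] -> [&& r d a, r d c, r e b & r e c] ->
    (d != b) && (e != a) && (d != e) -> d \in W -> e \in W -> c \in W ->
    ~~ (r y a && r y b).
  move=> yY /and3P[rab rac rbc] /and4P[rda rdc reb rec] /andP[/andP[db ea] de] dW eW cW'.
  have yNW z : z \in W -> (y == z) = false.
    by apply: contraTF => /eqP <-; case/setDP: yY.
  apply/negP => /andP[rya ryb].
  have := r_free rab rbc rac rya ryb rda rdc reb rec.
  by rewrite !yNW // (negPf db) (negPf ea) (negPf de).
have p1W : p1 \in W by rewrite !inE eqxx ?orbT.
have p2W : p2 \in W by rewrite !inE eqxx ?orbT.
have p3W : p3 \in W by rewrite !inE eqxx ?orbT.
have qW : q \in W by rewrite !inE eqxx ?orbT.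
have xW : x \in W by rewrite !inE eqxx ?orbT.
have deg_lb y : y \in S -> #|S| < 2 * (deg W y + deg Y y) by move/degS; rewrite (degID y sWS).
move: (deg_lb _ S1) (deg_lb _ S2) (deg_lb _ S3) (deg_lb _ Sq) (deg_lb _ Sx).
rewrite !degW !r_irr !adj !adj' (r_sym x q) -cY.
have f12 y (yY : y \in Y) : ~~ (r y p1 && r y p2).
  by apply: (@apex_free _ _ p3 q x); rewrite ?adj ?adj' ?neqs'.
have f13 y (yY : y \in Y) : ~~ (r y p1 && r y p3).
  by apply: (@apex_free _ _ p2 q x); rewrite ?adj ?adj' ?neqs'.
have f23 y (yY : y \in Y) : ~~ (r y p2 && r y p3).
  by apply: (@apex_free _ _ p1 q x); rewrite ?adj ?adj' ?neqs'.
have f1q y (yY : y \in Y) : ~~ (r y p1 && r y q).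
  by apply: (@apex_free _ _ p2 x p3); rewrite ?adj ?adj' ?neqs'.
have f2q y (yY : y \in Y) : ~~ (r y p2 && r y q).
  by apply: (@apex_free _ _ p1 x p3); rewrite ?adj ?adj' ?neqs'.
have f3q y (yY : y \in Y) : ~~ (r y p3 && r y q).
  by apply: (@apex_free _ _ p1 x p2); rewrite ?adj ?adj' ?neqs'.
have sum4 : \sum_(p <- [:: p1; p2; p3; q]) deg Y p <= #|Y| * 1.
  apply: sum_deg_leq => // y yY /=.
  move: (f12 y yY) (f13 y yY) (f23 y yY) (f1q y yY) (f2q y yY) (f3q y yY).
  by case: (r y p1); case: (r y p2); case: (r y p3); case: (r y q).
(* If q x is no edge, each p_i has at least (|Y| - 2)/2 neighbours in [Y] and [q] at least |Y|/2, in
   all 2|Y| - 3 > |Y| since |Y| >= 4. If it is an edge, these four give only 2|Y| - 4, so [x] must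
   be counted too. *)
case rqx: (r q x); last first.
  move: sum4 S9; rewrite !big_cons big_nil -cY; clear; lia.
have rxq : r x q by rewrite r_sym.
have f1x y (yY : y \in Y) : ~~ (r y p1 && r y x).
  by apply: (@apex_free _ _ p2 q p3); rewrite ?adj ?adj' ?neqs'.
have f2x y (yY : y \in Y) : ~~ (r y p2 && r y x).
  by apply: (@apex_free _ _ p1 q p3); rewrite ?adj ?adj' ?neqs'.
have f3x y (yY : y \in Y) : ~~ (r y p3 && r y x).
  by apply: (@apex_free _ _ p1 q p2); rewrite ?adj ?adj' ?neqs'.
have fqx y (yY : y \in Y) : ~~ (r y q && r y x).
  by apply: (@apex_free _ _ p1 p2 p3); rewrite ?adj ?adj' ?neqs' ?rqx.
have sum5 : \sum_(p <- [:: p1; p2; p3; q; x]) deg Y p <= #|Y| * 1.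
  apply: sum_deg_leq => // y yY /=.
  move: (f12 y yY) (f13 y yY) (f23 y yY) (f1q y yY) (f2q y yY) (f3q y yY).
  move: (f1x y yY) (f2x y yY) (f3x y yY) (fqx y yY).
  by case: (r y p1); case: (r y p2); case: (r y p3); case: (r y q); case: (r y x).
move: sum5 S9; rewrite !big_cons big_nil -cY; clear; lia.
Qed.

Definition K4_free S := forall x y z w,
  {subset [:: x; y; z; w] <= S} ->
  [&& r x y, r x z & r y z] -> ~~ [&& r w x, r w y & r w z].

Lemma T_free6 S : #|S| = 6 -> edges S S <= 2 * turan_value 6.
Proof.
move=> cS; rewrite leqNgt; apply/negP => dense.
have [x0 _] : exists x0, x0 \in S by apply/card_gt0P; rewrite cS.
have := forces_subgraph x0 forces_T isT cS dense.
case=> [[|b [|c [|e [|a [|d [|f [|? ?]]]]]]] [] //= _ uniq_s _].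
case/and5P=> rbc rce rbe rab /and5P[rac rdb rde rfc /andP[rfe _]].
have := r_free rbc rce rbe rab rac rdb rde rfc rfe.
move: uniq_s; rewrite !inE !negb_or -!andbA (eq_sym a e) (eq_sym d c) (eq_sym f b).
case: (b == f); case: (c == d); case: (e == a); case: (a == d); case: (a == f); case: (d == f);
  by rewrite ?andbF.
Qed.

Lemma T_free_K4_free S : 9 <= #|S| ->
  (forall y, y \in S -> #|S| < 2 * deg S y) ->
  (#|S| != 9 -> forall A, A \subset S -> #|A| = #|S| - 4 ->
     edges A A <= 2 * turan_value (#|S| - 4)) ->
  2 * turan_value #|S| < edges S S -> K4_free S.
Proof.
move=> S9 degS IH dense x y z w WS /and3P[rxy rxz ryz].
apply/negP => /and3P[rwx rwy rwz].
pose W := [set x; y; z; w]; pose Y := S :\: W.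
have sWS : W \subset S.
  by apply/subsetP => u uW; apply: WS; move: uW; rewrite !inE -!orbA.
have neqs := (adj_neq rxy, adj_neq rxz, adj_neq ryz,
  adj_neq (etrans (r_sym _ _) rwx), adj_neq (etrans (r_sym _ _) rwy),
  adj_neq (etrans (r_sym _ _) rwz)).
have cW : #|W| = 4.
  by rewrite /W -!setUA !cardsU1 cards1 !inE !negb_or !neqs.
have cY : #|Y| + 4 = #|S| by rewrite cardsD (setIidPr sWS) cW subnK // -cW subset_leq_card.
have degW u : deg W u = r u x + r u y + r u z + r u w.
  rewrite /deg /W -!setUA !big_setU1 ?big_set1 ?inE ?negb_or ?neqs //=.
  by rewrite !addnA.
have adj := (rxy, rxz, ryz, rwx, rwy, rwz, etrans (r_sym _ _) rxy, etrans (r_sym _ _) rxz,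
  etrans (r_sym _ _) ryz, etrans (r_sym _ _) rwx, etrans (r_sym _ _) rwy, etrans (r_sym _ _) rwz).
(* A vertex [u] joined to three vertices of the K_4 would form with them and the fourth, [q], a K_5
   minus an edge. *)
have noK5 p1 p2 p3 q u : u \in Y -> {subset [:: p1; p2; p3; q] <= [:: x; y; z; w]} ->
    [&& r p1 p2, r p1 p3 & r p2 p3] -> [&& r p1 q, r p2 q & r p3 q] ->
    ~~ [&& r u p1, r u p2 & r u p3].
  move=> /setDP[uS uNW] sub r3 r3q.
  have Wq : q \in W by have := sub q; rewrite !inE eqxx ?orbT -!orbA; apply.
  rewrite ![r u _]r_sym; apply: (K5minus_free S9 degS _ _ r3 r3q).
    move=> v; rewrite -[_ :: _]/([:: p1; p2; p3; q] ++ [:: u]) mem_cat => /orP[/sub/WS //|].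
    by rewrite inE => /eqP->.
  by apply: contraNneq uNW => <-.
have YW : edges Y W <= #|Y| * 2.
  apply: sum_leq_const => u uY; rewrite degW.
  have Nxyz : ~~ [&& r u x, r u y & r u z] by apply: (noK5 x y z w); rewrite ?adj.
  have Nxyw : ~~ [&& r u x, r u y & r u w].
    by apply: (noK5 x y w z); rewrite ?adj // => v; rewrite !inE; do !case: eqP.
  have Nxzw : ~~ [&& r u x, r u z & r u w].
    by apply: (noK5 x z w y); rewrite ?adj // => v; rewrite !inE; do !case: eqP.
  have Nyzw : ~~ [&& r u y, r u z & r u w].
    by apply: (noK5 y z w x); rewrite ?adj // => v; rewrite !inE; do !case: eqP.
  by move: Nxyz Nxyw Nxzw Nyzw; case: (r u x); case: (r u y); case: (r u z); case: (r u w).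
have WW : edges W W <= 12 by apply: leq_trans (edges_leq W) _; rewrite cW.
have dec : edges S S <= 12 + edges Y Y + 4 * #|Y|.
  by rewrite (edgesID sWS) (edgesC W); move: YW WW; rewrite -/Y; clear; lia.
have [S_eq9|S_neq9] := eqVneq #|S| 9; last first.
  have := IH S_neq9 Y (subsetDl _ _); rewrite -cY addnK => /(_ erefl) IHY.
  by move: IHY dec dense; rewrite -cY turan_valueD4; clear; lia.
have Y5 : #|Y| = 5 by move: cY; rewrite S_eq9; clear; lia.
(* Of more than 2 * 24 ordered pairs, at most 12 + 20 meet [W]; at least 17 remain, hence nine edges
   by parity. *)
have dense5 : 2 * 9 <= (edges Y Y).+1.
  by move: dec dense; rewrite S_eq9 Y5 (turan_value4D1 2); clear; lia.
have := forces_subgraph x forces_K5minus isT Y5 dense5.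
case=> [[|a [|b [|c [|d [|e [|? ?]]]]]] [] //= _ uniq_s sY].
case/and5P=> rab rac rbc rad /and5P[rbd rcd rae rbe /andP[rce _]].
have de : d != e.
  have : uniq ([:: a; b; c] ++ [:: d; e]) by exact: uniq_s.
  by rewrite cat_uniq /= !inE andbT; case: (d == e); rewrite ?andbF.
have sS : {subset [:: a; b; c; d; e] <= S} by move=> v /sY /setDP[].
have := K5minus_free S9 degS sS de.
by rewrite rab rac rbc rad rbd rcd rae rbe rce => /(_ isT isT).
Qed.

(** * Light edges in K_4-free graphs *)

Lemma exists_codeg S x y z : 2 <= codeg S x y ->
  exists2 w, w \in S & [&& w != z, r w x & r w y].
Proof.
rewrite /codeg sum_bool_card => /card_gt1P[a [b [/setIdP[aS /andP[xa ya]]]]].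
move=> /setIdP[bS /andP[xb yb]] ab.
have [az|az] := eqVneq a z; last by exists a => //; rewrite az !(r_sym a) xa.
by exists b => //; rewrite -az eq_sym ab !(r_sym b) xb.
Qed.

Lemma light_edge S x y z : K4_free S -> {subset [:: x; y; z] <= S} ->
  [&& r x y, r x z & r y z] ->
  [|| codeg S x y < 2, codeg S x z < 2 | codeg S y z < 2].
Proof.
move=> K4S sub r3; have /and3P[rxy rxz ryz] := r3; apply/negPn.
rewrite !negb_or -!leqNgt; apply/negP => /and3P[].
move=> /(@exists_codeg _ _ _ z)[a aS /and3P[az rax ray]].
move=> /(@exists_codeg _ _ _ y)[b bS /and3P[byn rbx rbz]].
move=> /(@exists_codeg _ _ _ x)[c cS /and3P[cx rcy rcz]].
(* An apex shared by two sides would see all of [x], [y], [z]; so [a], [b], [c] are distinct and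
   complete a T. *)
have noK4 w : w \in S -> ~~ [&& r w x, r w y & r w z].
  move=> wS; apply: K4S r3 => v; rewrite -[_ :: _]/([:: x; y; z] ++ [:: w]) mem_cat.
  by case/orP=> [/sub //|]; rewrite inE => /eqP->.
have := r_free rxy ryz rxz rax ray rbx rbz rcy rcz.
rewrite (negPf az) (negPf byn) (negPf cx) /= => /or3P[] /eqP ab.
- by have := noK4 a aS; rewrite {3}ab rax ray rbz.
- by have := noK4 a aS; rewrite {3}ab rax ray rcz.
- by have := noK4 b bS; rewrite {2}ab rbx rcy rbz.
Qed.

Lemma exists_triangle S : 0 < #|S| -> (forall y, y \in S -> #|S| < 2 * deg S y) ->
  exists x y z, {subset [:: x; y; z] <= S} /\ [&& r x y, r x z & r y z].
Proof.
move=> /card_gt0P[x xS] degS.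
have [y yS rxy] : exists2 y, y \in S & r x y.
  have : 0 < deg S x by move: (degS x xS); clear; lia.
  by rewrite /deg sum_bool_card => /card_gt0P[y /setIdP[]]; exists y.
have [z zS /andP[rxz ryz]] : exists2 z, z \in S & r x z && r y z.
  have : 0 < codeg S x y by move: (deg_codeg S x y) (degS x xS) (degS y yS); clear; lia.
  by rewrite /codeg sum_bool_card => /card_gt0P[z /setIdP[]]; exists z.
exists x, y, z; rewrite rxy rxz ryz; split=> // v; rewrite !inE.
by case/or3P=> /eqP->.
Qed.

(** Two vertices of degree at least |S|/2 + 1 have two common neighbours, so no side of a triangle
    could be light. *)
Lemma K4_free_low_degree S : 0 < #|S| -> K4_free S ->
  ~ (forall y, y \in S -> #|S| + 2 <= 2 * deg S y).
Proof.
move=> S0 K4S degS.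
have [|x [y [z [sub r3]]]] := exists_triangle S0.
  by move=> y /degS; clear; lia.
have := light_edge K4S sub r3.
have degS' v : v \in [:: x; y; z] -> #|S| + 2 <= 2 * deg S v by move/sub/degS.
have: #|S| + 2 <= 2 * deg S x by apply: degS'; rewrite !inE eqxx.
have: #|S| + 2 <= 2 * deg S y by apply: degS'; rewrite !inE eqxx orbT.
have: #|S| + 2 <= 2 * deg S z by apply: degS'; rewrite !inE eqxx !orbT.
move: (deg_codeg S x y) (deg_codeg S x z) (deg_codeg S y z); clear.
by move=> c1 c2 c3 dz dy dx /or3P[]; lia.
Qed.

(** Inclusion-exclusion gives deg u + deg v <= |S| + 1 = 2m, so everything is tight: no vertex
    misses both ends, and [w] is their only common neighbour. *)
Lemma light_edgeP S m u v : #|S|.+1 = 2 * m -> (forall y, y \in S -> m <= deg S y) ->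
  u \in S -> v \in S -> codeg S u v < 2 ->
  deg S u = m /\ forall w, w \in S -> r u w -> r v w ->
    forall z, z \in S -> z != w -> r v z = ~~ r u z.
Proof.
move=> cS degS uS vS light.
have total : deg S u + deg S v + \sum_(z in S) (~~ r u z && ~~ r v z) = #|S| + codeg S u v.
  rewrite -sum1_card -!big_split /=; apply: eq_bigr => z _.
  by case: (r u z); case: (r v z).
have := (degS u uS, degS v vS) => -[du dv].
have [degu nn0] : deg S u = m /\ \sum_(z in S) (~~ r u z && ~~ r v z) = 0.
  by move: total cS du dv light; clear; lia.
split=> // w wS ruw rvw z zS zw.
move/eqP: nn0; rewrite sum_nat_eq0 => /forall_inP/(_ z zS).
case ruz: (r u z); case rvz: (r v z) => //= _.
move: light; rewrite ltnS /codeg sum_bool_card => /card_le1_eqP uniq_common.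
by case/eqP: zw; apply: uniq_common; rewrite inE ?zS ?wS ?ruz ?rvz ?ruw ?rvw.
Qed.

(* Compare [edges S S] with the bound for [S] minus [u], [v], [w], which is small because
   [#|S| - 3] is 2 modulo 4. *)
Lemma light_apex_degree S k u v w : #|S| = 4 * k + 1 ->
  (forall A, A \subset S -> #|A| = #|S| - 3 -> edges A A <= 2 * turan_value (#|S| - 3)) ->
  2 * turan_value #|S| < edges S S ->
  {subset [:: u; v; w] <= S} -> [&& r u v, r u w & r v w] ->
  deg S u = 2 * k + 1 -> deg S v = 2 * k + 1 -> 2 * k + 3 <= deg S w.
Proof.
case: k => [|k] cS IH dense sub /and3P[ruv ruw rvw] du dv.
  have : #|[set u; v]| <= #|S|.
    apply/subset_leq_card/subsetP=> x xuv; apply: sub; move: xuv.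
    by rewrite !inE => /orP[]->; rewrite ?orbT.
  by rewrite cards2 adj_neq // cS.
have uS : u \in S by apply: sub; rewrite !inE eqxx.
have vS : v \in S :\ u by rewrite in_setD1 eq_sym adj_neq //= sub // !inE eqxx orbT.
have wS : w \in S :\ u :\ v.
  by rewrite !in_setD1 !(eq_sym w) !adj_neq //= sub // !inE eqxx !orbT.
have := IH (S :\ u :\ v :\ w).
rewrite (subset_trans (subsetDl _ _)) ?(subset_trans (subsetDl _ _)) ?subsetDl // => /(_ isT).
have cS3 : #|S :\ u :\ v :\ w| = #|S| - 3.
  move: (cardsD1 u S) (cardsD1 v (S :\ u)) (cardsD1 w (S :\ u :\ v)).
  by rewrite uS vS wS; clear; lia.
move/(_ cS3).
have := edgesD1 uS; have := edgesD1 vS; have := edgesD1 wS.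
have := degD1 v uS; have := degD1 w uS; have := degD1 w vS.
rewrite !(r_sym v u) !(r_sym w u) !(r_sym w v) ruv ruw rvw.
(* With K for [k.+1], the bounds for 4K + 1 and 4K - 2 differ by 6K + 1. So at least 6K + 2 edges
   meet the triangle, that is, deg u + deg v + deg w - 3 >= 6K + 2. *)
move: dense; rewrite cS.
have -> : 4 * k.+1 + 1 - 3 = 4 * k + 2 by clear; lia.
rewrite !turan_valueE; move: du dv; clear; lia.
Qed.

(** Each edge is charged to an end of degree one, which is charged only once; [F x y] marks the edge
    x y as chargeable to [x]. *)
Lemma star_forest_edges A :
  (forall x y, x \in A -> y \in A -> r x y -> (deg A x <= 1) || (deg A y <= 1)) ->
  edges A A <= 2 * \sum_(x in A) (0 < deg A x).
Proof.
move=> star.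
pose F x y : nat := r x y && (deg A x <= 1).
have leF : edges A A <= \sum_(x in A) \sum_(y in A) (F x y + F y x).
  apply: leq_sum => x xA; apply: leq_sum => y yA; rewrite /F (r_sym y x).
  by case rxy: (r x y) => //; move: (star x y xA yA rxy); do 2!case: (_ <= 1).
apply: leq_trans leF _.
under eq_bigr do rewrite big_split /=.
rewrite big_split /= [X in _ + X]exchange_big /= addnn -mul2n leq_mul2l /=.
apply: leq_sum => x xA; have [dx|dx] := leqP (deg A x) 1; last first.
  by rewrite big1 // => y _; rewrite /F leqNgt dx andbF.
under eq_bigr do rewrite /F dx andbT.
by rewrite -/(deg A x); case: (deg A x) dx => [|[|]].
Qed.

(* [u v] is a light edge with apex [w]; the neighbours of [w] split into those adjacent to [v],
   which are twins of [u], and those adjacent to [u], which are twins of [v]. *)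
Lemma side_edges S u v w : K4_free S -> u \in S -> w \in S -> r u w ->
  (forall z, z \in S -> z != w -> r v z = ~~ r u z) ->
  (forall p, p \in S -> r w p -> r v p -> forall z, z \in S -> z != w -> r p z = r u z) ->
  (forall q, q \in S -> r w q -> r u q -> forall z, z \in S -> z != w -> r q z = r v z) ->
  2 <= deg [set z in S :\ w | r v z] w ->
  edges [set z in S :\ w | r u z] [set z in S :\ w | r u z]
    + 2 * deg [set z in S :\ w | r u z] w <= 2 * #|[set z in S :\ w | r u z]|.
Proof.
move=> K4S uS wS ruw opp twin_u twin_v; set X := [set z in _ | r u z].
set Y := [set z in _ | r v z] => dY.
have XP x : x \in X -> [/\ x \in S, x != w & r u x].
  by case/setIdP=> /setD1P[].
have sYS : Y \subset S by apply/subsetP=> y /setIdP[/setD1P[]].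
have sXS : X \subset S by apply/subsetP=> y /setIdP[/setD1P[]].
(* The neighbours of [w] in [Y] are twins of [u], so at least two vertices see both [x] and [y].
   Hence u x or u y is the light side of u x y, and its codegree bounds a degree in [X]. *)
have star x y : x \in X -> y \in X -> r x y -> (deg X x <= 1) || (deg X y <= 1).
  move=> xX yX rxy; have [xS xw rux] := XP _ xX; have [yS yw ruy] := XP _ yX.
  have deg_le z : deg X z <= codeg S u z.
    rewrite /codeg (big_setID X) /= (setIidPr sXS) -[leqLHS]addn0 leq_add //.
    by apply: leq_sum => t /XP[_ _ ->].
  have common : 2 <= codeg S x y.
    apply: leq_trans dY _; rewrite /codeg (big_setID Y) /= (setIidPr sYS).
    rewrite -[leqLHS]addn0 leq_add //; apply: leq_sum => p /setIdP[/setD1P[pw pS] rvp].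
    case rwp: (r w p) => //; rewrite !(r_sym _ p).
    by rewrite !(twin_u p pS rwp rvp) // rux ruy.
  have sub : {subset [:: u; x; y] <= S} by move=> t; rewrite !inE => /or3P[]/eqP->.
  have := light_edge K4S sub.
  rewrite rux ruy rxy ![codeg S x y < 2]ltnNge common orbF => /(_ isT)/orP[] lt2.
    by rewrite (leq_trans (deg_le x)).
  by rewrite (leq_trans (deg_le y)) ?orbT.
apply: leq_trans (_ : 2 * \sum_(x in X) (0 < deg X x) + 2 * deg X w <= _).
  by rewrite leq_add2r star_forest_edges.
(* A neighbour of [w] in [X] is a twin of [v], hence isolated in [X]; each vertex contributes to
   only one of the two sums. *)
rewrite -mulnDr leq_mul2l /= -big_split -sum1_card; apply: leq_sum => x xX /=.
have [xS xw rux] := XP _ xX; case rwx: (r w x); last by case: (0 < _).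
rewrite /deg big1 // => y /XP[yS yw ruy].
by rewrite (twin_v x xS rwx rux) // opp // ruy.
Qed.

Lemma K4_free_edges1 S k : #|S| = 4 * k + 1 ->
  (forall A, A \subset S -> #|A| = #|S| - 3 -> edges A A <= 2 * turan_value (#|S| - 3)) ->
  (forall y, y \in S -> 2 * k + 1 <= deg S y) -> K4_free S ->
  edges S S <= 2 * turan_value #|S|.
Proof.
move=> cS IH degS K4S; rewrite leqNgt; apply/negP => dense.
have cS' : #|S|.+1 = 2 * (2 * k + 1) by rewrite cS; clear; lia.
have [u [v [w [sub r3 luv]]]] : exists u v w, [/\ {subset [:: u; v; w] <= S},
    [&& r u v, r u w & r v w] & codeg S u v < 2].
  have [||x [y [z [sub r3]]]] := @exists_triangle S.
  - by rewrite cS addn1.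
  - by move=> y /degS; rewrite cS; clear; lia.
  have := light_edge K4S sub r3; case/and3P: r3 => rxy rxz ryz.
  case/or3P => lt2.
  - by exists x, y, z; rewrite rxy rxz ryz.
  - exists x, z, y; rewrite rxy rxz r_sym ryz; split=> // t tin; apply: sub.
    by move: tin; rewrite !inE => /or3P[]->; rewrite ?orbT.
  - exists y, z, x; rewrite ryz !(r_sym _ x) rxy rxz; split=> // t tin; apply: sub.
    by move: tin; rewrite !inE => /or3P[]->; rewrite ?orbT.
have uS : u \in S by apply: sub; rewrite !inE eqxx.
have vS : v \in S by apply: sub; rewrite !inE eqxx orbT.
have wS : w \in S by apply: sub; rewrite !inE eqxx !orbT.
have /and3P[ruv ruw rvw] := r3.
have [du opp] := light_edgeP cS' degS uS vS luv.
have lvu : codeg S v u < 2 by rewrite codegC.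
have [dv _] := light_edgeP cS' degS vS uS lvu.
have {}opp := opp w wS ruw rvw.
have dw := light_apex_degree cS IH dense sub r3 du dv.
(* A light side at [w] would force deg w = 2k + 1, so the light side of w x y is x y. *)
have nb_light x y : x \in S -> y \in S -> r w x -> r w y -> r x y -> codeg S x y < 2.
  move=> xS yS rwx rwy rxy.
  have subw : {subset [:: w; x; y] <= S} by move=> t; rewrite !inE => /or3P[]/eqP->.
  have := light_edge K4S subw; rewrite rwx rwy rxy => /(_ isT)/or3P[] // lt2.
    by have [] := light_edgeP cS' degS wS xS lt2; move: dw; clear; lia.
  by have [] := light_edgeP cS' degS wS yS lt2; move: dw; clear; lia.
have [rwu rwv] : r w u /\ r w v by rewrite !(r_sym w).
have opp' z : z \in S -> z != w -> r u z = ~~ r v z by move=> zS zw; rewrite opp ?negbK.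
(* Apart from [w], both [p] and [u] have the neighbourhood complementary to that of [v], since v p
   is light with apex [w]. *)
have twin_u p : p \in S -> r w p -> r v p -> forall z, z \in S -> z != w -> r p z = r u z.
  move=> pS rwp rvp z zS zw; have lvp := nb_light v p vS pS rwv rwp rvp.
  have [_ oppv] := light_edgeP cS' degS vS pS lvp.
  have rpw : r p w by rewrite r_sym.
  by rewrite (oppv w wS rvw rpw z zS zw) opp ?negbK.
have twin_v q : q \in S -> r w q -> r u q -> forall z, z \in S -> z != w -> r q z = r v z.
  move=> qS rwq ruq z zS zw; have luq := nb_light u q uS qS rwu rwq ruq.
  have [_ oppu] := light_edgeP cS' degS uS qS luq.
  have rqw : r q w by rewrite r_sym.
  by rewrite (oppu w wS ruw rqw z zS zw) opp.
pose X := [set z in S :\ w | r u z]; pose Y := [set z in S :\ w | r v z].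
have cX : #|X| = 2 * k.
  by move: (degD1 u wS); rewrite ruw du /deg sum_bool_card -/X; clear; lia.
have cY : #|Y| = 2 * k.
  by move: (degD1 v wS); rewrite rvw dv /deg sum_bool_card -/Y; clear; lia.
have sXS : X \subset S :\ w by apply/subsetP=> x /setIdP[].
have YE : Y = (S :\ w) :\: X.
  apply/setP=> z; rewrite !inE.
  case zw: (z == w); case zS: (z \in S); rewrite ?andbF //=.
  by rewrite opp ?zw ?andbT.
have dwE : deg S w = deg X w + deg Y w by rewrite -(degD1_self S) (degID w sXS) -YE.
have dX := deg_leq_card X w; have dY := deg_leq_card Y w.
have sideX := side_edges K4S uS wS ruw opp twin_u twin_v.
have sideY := side_edges K4S vS wS rvw opp' twin_v twin_u.
(* As deg w >= 2k + 3 and each side has 2k vertices, [w] has at least three neighbours in either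
   side. *)
have {}sideX : edges X X + 2 * deg X w <= 2 * #|X|.
  by apply: sideX; rewrite -/Y; move: dw dwE dX cX; clear; lia.
have {}sideY : edges Y Y + 2 * deg Y w <= 2 * #|Y|.
  by apply: sideY; rewrite -/X; move: dw dwE dY cY; clear; lia.
have XY : edges X Y <= #|X| * #|Y| by apply: sum_leq_const => x _; apply: deg_leq_card.
(* The terms 2 deg w cancel, leaving at most 4k + 4k + 2(2k)^2, twice the claimed value. *)
move: dense; rewrite cS turan_value4D1 (edgesD1 wS) (edgesID sXS) -YE.
by move: sideX sideY XY dwE; rewrite cX cY; clear; lia.
Qed.

(** * The induction for the upper bound *)

Lemma T_free_edges S : #|S| != 5 -> edges S S <= 2 * turan_value #|S|.
Proof.
have [n] := ubnP #|S|; elim: n => // n IHn in S *; rewrite ltnS => Sn S5.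
have IH A : A \subset S -> #|A| < #|S| -> #|A| != 5 -> edges A A <= 2 * turan_value #|A|.
  by move=> _ AS A5; apply: IHn => //; apply: leq_trans AS Sn.
have [S_le4|S_gt4] := leqP #|S| 4.
  (* Up to four vertices the claimed value counts all pairs. *)
  apply: leq_trans (edges_leq S) _.
  by case: #|S| S_le4 => [|[|[|[|[|]]]]].
have [S6|S6] := eqVneq #|S| 6; first by rewrite S6 T_free6.
have S7 : 7 <= #|S| by move: S_gt4 S5 S6; clear; lia.
rewrite leqNgt; apply/negP => dense.
have del x : x \in S -> edges S S <= 2 * turan_value (#|S|.-1) + 2 * deg S x.
  move=> xS; rewrite (edgesD1 xS) leq_add2r.
  have cSx : #|S :\ x| = #|S|.-1 by rewrite (cardsD1 x S) xS.
  by rewrite -cSx; apply: IH; rewrite ?subsetDl // cSx; move: S7 S6; clear; lia.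
have avg : #|S| * edges S S <= #|S| * (2 * turan_value #|S|.-1) + 2 * edges S S.
  have -> : 2 * edges S S = \sum_(x in S) 2 * deg S x by rewrite -big_distrr.
  by rewrite -!sum_nat_const -big_split; apply: leq_sum.
have IHj j A : A \subset S -> 0 < j -> #|S| != j + 5 -> #|A| = #|S| - j ->
    edges A A <= 2 * turan_value (#|S| - j).
  by move=> AS j0 Sj cA; rewrite -cA; apply: IH; rewrite // cA; move: S7 j0 Sj; clear; lia.
have K4S : 9 <= #|S| -> (forall y, y \in S -> #|S| < 2 * deg S y) -> K4_free S.
  move=> S9 degS; apply: (T_free_K4_free S9 degS) => // S9' A AS.
  exact: IHj.
have := divn_eq #|S| 4; set k := #|S| %/ 4.
have : #|S| %% 4 < 4 by rewrite ltn_mod.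
case: (#|S| %% 4) => [|[|[|[|]]]] // _ cS.
- have {}cS : #|S| = 4 * k.-1.+1 by move: cS S7; clear; lia.
  (* With K for [k.-1.+1], averaging reads (4K - 2) e <= 8K (4K^2 - 1), so e <= 4K (2K + 1), exactly
     twice the bound. *)
  move: dense avg; rewrite cS; have -> : (4 * k.-1.+1).-1 = 4 * k.-1 + 3 by clear; lia.
  rewrite !turan_valueE; move: S7; rewrite cS; clear; move: (edges _ _) k.-1 => e j; nia.
- have {}cS : #|S| = 4 * k + 1 by move: cS; clear; lia.
  have degS y : y \in S -> 2 * k + 1 <= deg S y.
    move/del; move: dense; rewrite cS; have -> : (4 * k + 1).-1 = 4 * k by clear; lia.
    rewrite !turan_valueE; clear; lia.
  have S9 : 9 <= #|S| by move: cS S7; clear; lia.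
  move: dense; apply/negP; rewrite -leqNgt; apply: (K4_free_edges1 cS) => //.
    by move=> A AS; apply: IHj => //; move: cS; clear; lia.
  by apply: K4S => // y /degS; rewrite cS; clear; lia.
- have {}cS : #|S| = 4 * k + 2 by move: cS; clear; lia.
  have S9 : 9 <= #|S| by move: cS S7 S6; clear; lia.
  have degS y : y \in S -> #|S| + 2 <= 2 * deg S y.
    move/del; move: dense; rewrite cS; have -> : (4 * k + 2).-1 = 4 * k + 1 by clear; lia.
    rewrite !turan_valueE; clear; lia.
  apply: (@K4_free_low_degree S) => //; first by move: S9; clear; lia.
  by apply: K4S => // y /degS; clear; lia.
- have {}cS : #|S| = 4 * k + 3 by move: cS; clear; lia.
  (* This is tight: (4k + 1)(8k^2 + 16k + 7) exceeds (4k + 3)(8k^2 + 12k + 2) by exactly 1. *)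
  move: dense avg; rewrite cS; have -> : (4 * k + 3).-1 = 4 * k + 2 by clear; lia.
  rewrite !turan_valueE; move: S7; rewrite cS; clear; move: (edges _ _) k => e j; nia.
Qed.

End Graph.

(** * Translation between edge sets and adjacency relations *)

Definition adjacent (V : finType) (E : {set {set V}}) : rel V :=
  fun x y => [set x; y] \in E.

Definition edge_set (V : finType) (r : rel V) : {set {set V}} :=
  [set [set p.1; p.2] | p in [pred p : V * V | r p.1 p.2]].

Lemma eq_set2 (V : finType) (x y a b : V) :
  [set x; y] = [set a; b] -> x = a /\ y = b \/ x = b /\ y = a.
Proof.
move=> eq_xy.
have x_ab : x \in [set a; b] by rewrite -eq_xy set21.
have y_ab : y \in [set a; b] by rewrite -eq_xy set22.
have a_xy : a \in [set x; y] by rewrite eq_xy set21.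
have b_xy : b \in [set x; y] by rewrite eq_xy set22.
rewrite !inE in x_ab y_ab a_xy b_xy.
have [xa|xa] := eqVneq x a; [left | right; move: x_ab]; last first.
  rewrite (negPf xa) /= => /eqP xb; split=> //.
  by move: a_xy; rewrite (eq_sym a x) (negPf xa) => /eqP.
split=> //; case/orP: y_ab => /eqP // ya.
by move: b_xy; rewrite xa -ya orbb => /eqP.
Qed.

Section GraphOfEdges.

Variables (V : finType) (E : {set {set V}}).
Hypothesis simpleE : simple_graph E.

Lemma adjacent_sym : symmetric (adjacent E).
Proof. by move=> x y; rewrite /adjacent setUC. Qed.

Lemma adjacent_irr : irreflexive (adjacent E).
Proof.
move=> x; apply/negP => /(forall_inP simpleE).
by rewrite setUid cards1.
Qed.

Lemma edges_adjacent : edges (adjacent E) setT setT = 2 * #|E|.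
Proof.
rewrite /edges /deg pair_big_dep /=.
under eq_bigl do rewrite !inE.
transitivity (\sum_(p | adjacent E p.1 p.2) 1).
  by rewrite [RHS]big_mkcond; apply: eq_bigr => p _ /=; case: (adjacent _ _ _).
rewrite (partition_big (fun p : V * V => [set p.1; p.2]) (mem E)) //=.
rewrite mulnC -sum_nat_const; apply: eq_bigr => e eE.
have /cards2P[a [b] [ab eE']] := forall_inP simpleE e eE.
transitivity #|[set (a, b); (b, a)]|; last first.
  by rewrite cards2 xpair_eqE negb_and ab.
rewrite -sum1_card; apply: eq_bigl => -[x y] /=; rewrite !inE !xpair_eqE eE'.
apply/andP/orP => [[_ /eqP/eq_set2[][-> ->]]|[]/andP[/eqP-> /eqP->]].
- by left; rewrite !eqxx.
- by right; rewrite !eqxx.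
- by rewrite /adjacent -eE'.
- by rewrite /adjacent setUC -eE'.
Qed.

Lemma T_free_adjacent :
  ~~ contains_copy E flattened_tetrahedron <-> T_free (adjacent E).
Proof.
rewrite /T_free /adjacent; split=> [no_copy b c e a d f|free].
  move=> bc ce be ab ac db de fc fe; apply: contraR no_copy.
  rewrite !negb_or => /and5P[ae dc fb ad /andP[af df]].
  pose s := [:: a; b; c; d; e; f].
  have uniq_s : uniq s.
    have neq x y : [set x; y] \in E -> x != y by apply: (adj_neq adjacent_irr).
    rewrite /= !inE !negb_or ae ad af df !(eq_sym _ d) !(eq_sym _ f) dc fb.
    by rewrite !neq // setUC.
  apply/existsP; exists [ffun i : 'I_6 => nth b s i]; apply/andP; split.
    apply/injectiveP => i j; rewrite !ffunE => /eqP.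
    by rewrite nth_uniq // => /eqP/val_inj.
  apply/subsetP => _ /imsetP[h hT ->]; move: hT.
  rewrite !inE => /or4P[|||/or4P[|||/or3P[]]] /eqP->;
  by rewrite !imsetU1 imset_set1 !ffunE /= // setUC.
apply/negP => /existsP[g /andP[/injectiveP g_inj /subsetP sE]].
pose v k (lt6 : k < 6) := g (Ordinal lt6).
have edge i j : [set i; j] \in flattened_tetrahedron -> [set g i; g j] \in E.
  move=> ij; apply: sE; apply/imsetP; exists [set i; j] => //.
  by rewrite imsetU1 imset_set1.
(* The ordinals 0 to 5 stand for a to f, taken here in the order b, c, e, a, d, f. *)
have := free (v 1 isT) (v 2 isT) (v 4 isT) (v 0 isT) (v 3 isT) (v 5 isT).
rewrite !(inj_eq g_inj) /=.
have -> : [set v 1 isT; v 2 isT] \in E by apply: edge; rewrite !inE !eqxx ?orbT.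
have -> : [set v 2 isT; v 4 isT] \in E by apply: edge; rewrite !inE !eqxx ?orbT.
have -> : [set v 1 isT; v 4 isT] \in E by rewrite setUC; apply: edge; rewrite !inE !eqxx ?orbT.
have -> : [set v 0 isT; v 1 isT] \in E by apply: edge; rewrite !inE !eqxx ?orbT.
have -> : [set v 0 isT; v 2 isT] \in E by apply: edge; rewrite !inE !eqxx ?orbT.
have -> : [set v 3 isT; v 1 isT] \in E by rewrite setUC; apply: edge; rewrite !inE !eqxx ?orbT.
have -> : [set v 3 isT; v 4 isT] \in E by apply: edge; rewrite !inE !eqxx ?orbT.
have -> : [set v 5 isT; v 2 isT] \in E by rewrite setUC; apply: edge; rewrite !inE !eqxx ?orbT.
have -> : [set v 5 isT; v 4 isT] \in E by apply: edge; rewrite !inE !eqxx ?orbT.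
by do 9!move/(_ isT).
Qed.

End GraphOfEdges.

(** * The lower bound construction *)

Section EdgesOfGraph.

Variables (V : finType) (r : rel V).
Hypotheses (r_sym : symmetric r) (r_irr : irreflexive r).

Lemma simple_edge_set : simple_graph (edge_set r).
Proof.
by apply/forall_inP => _ /imsetP[[x y] /= rxy ->]; rewrite cards2 (adj_neq r_irr).
Qed.

Lemma adjacent_edge_set : adjacent (edge_set r) =2 r.
Proof.
move=> x y; apply/imsetP/idP => [[[a b] /= rab /eq_set2[][-> ->]]|rxy] //.
  by rewrite r_sym.
by exists (x, y).
Qed.

(** T has no 2-colouring in which each vertex has at most one neighbour of its own colour. Two
    central vertices, say [b] and [c], agree; then [e], [d], [f] all have the other colour, and [e]
    sees both [d] and [f]. All 64 colourings are checked. *)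
Lemma T_free_bicolored (col : V -> bool) :
  (forall x y z, r x y -> r x z -> col x = col y -> col x = col z -> y = z) ->
  T_free r.
Proof.
move=> matching b c e a d f bc ce be ab ac db de fc fe.
have fact x y z : r x y -> r x z -> ~~ [&& col x == col y, col x == col z & y != z].
  move=> rxy rxz; apply/negP => /and3P[/eqP cy /eqP cz /eqP]; apply.
  exact: matching cz.
have neq := (adj_neq r_irr bc, adj_neq r_irr ce, adj_neq r_irr be, adj_neq r_irr ab,
  adj_neq r_irr ac, adj_neq r_irr db, adj_neq r_irr de, adj_neq r_irr fc, adj_neq r_irr fe).
apply: contraT; rewrite !negb_or => /and5P[ae dc fb ad /andP[af df]].
have sym x y : r x y -> r y x by rewrite r_sym.
have [[cb ec] eb] := (sym _ _ bc, sym _ _ ce, sym _ _ be).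
have [[ba ca] bd] := (sym _ _ ab, sym _ _ ac, sym _ _ db).
have [[ed cf] ef] := (sym _ _ de, sym _ _ fc, sym _ _ fe).
move: (fact b c e bc be) (fact b c a bc ba) (fact b c d bc bd).
move: (fact b e a be ba) (fact b e d be bd) (fact b a d ba bd).
move: (fact c b e cb ce) (fact c b a cb ca) (fact c b f cb cf).
move: (fact c e a ce ca) (fact c e f ce cf) (fact c a f ca cf).
move: (fact e b c eb ec) (fact e b d eb ed) (fact e b f eb ef).
move: (fact e c d ec ed) (fact e c f ec ef) (fact e d f ed ef).
rewrite !(eq_sym b a) !(eq_sym b d) !(eq_sym c a) !(eq_sym c f) !(eq_sym e).
rewrite !(eq_sym c d) !(eq_sym b f) !neq ae dc fb ad af df !andbT.
by case: (col a); case: (col b); case: (col c); case: (col d); case: (col e); case: (col f).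
Qed.

End EdgesOfGraph.

(* Vertices are paired as {2 i, 2 i + 1}; the pairs are put alternately in the two classes of a
   complete bipartite graph, and each pair is an edge. *)
Definition extremal_rel : rel nat := fun i j =>
  (odd i./2 != odd j./2) || (i./2 == j./2) && (i != j).

Lemma extremal_rel_sym : symmetric extremal_rel.
Proof. by move=> i j; rewrite /extremal_rel !(eq_sym i) !(eq_sym i./2) (eq_sym (odd i./2)). Qed.

Lemma extremal_rel_irr : irreflexive extremal_rel.
Proof. by move=> i; rewrite /extremal_rel !eqxx. Qed.

Lemma extremal_rel_matching i j l : extremal_rel i j -> extremal_rel i l ->
  odd i./2 = odd j./2 -> odd i./2 = odd l./2 -> j = l.
Proof.
rewrite /extremal_rel => + + oj ol; rewrite oj -ol oj !eqxx /=.
move=> /andP[/eqP hj /eqP ij] /andP[/eqP hl /eqP il]; clear oj ol; lia.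
Qed.

(** Each block of four consecutive vertices has two in either class, and a later [j] sees just the
    two in the class opposite to its own. *)
Lemma extremal_rel_blocks k j : 4 * k <= j -> \sum_(i < 4 * k) extremal_rel i j = 2 * k.
Proof.
elim: k => [|k IHk] k_j; first by rewrite big_ord0.
have -> : 4 * k.+1 = (4 * k).+4 by rewrite mulnS addnC addn4.
rewrite !big_ord_recr /= IHk; last by move: k_j; clear; lia.
have block t : t < 4 -> extremal_rel (4 * k + t) j = ((1 < t) != odd j./2).
  move=> t4; rewrite /extremal_rel; have -> : odd (4 * k + t)./2 = (1 < t) by move: t4; clear; lia.
  have -> : ((4 * k + t)./2 == j./2) = false by apply/eqP; move: k_j t4; clear; lia.
  by rewrite orbF.
have := block 0 isT; have := block 1 isT; have := block 2 isT; have := block 3 isT.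
rewrite addn0 addn1 addn2 addn3 => -> -> -> ->.
by case: (odd j./2); clear; lia.
Qed.

Lemma extremal_rel_shift k i j : extremal_rel (4 * k + i) (4 * k + j) = extremal_rel i j.
Proof.
rewrite /extremal_rel eqn_add2l; have half t : (4 * k + t)./2 = 2 * k + t./2 by clear; lia.
have odd2 t : odd (2 * k + t) = odd t by clear; lia.
by rewrite !half !odd2 eqn_add2l.
Qed.

(** For n = 4k + t with t < 4, the new vertex sees 2k vertices of the full blocks and all t earlier
    ones of its own block, which spans a K_4. *)
Lemma extremal_rel_degree n :
  turan_value n + \sum_(i < n) extremal_rel i n = turan_value n.+1.
Proof.
rewrite (divn_eq n 4) (mulnC _ 4); set k := n %/ 4.
have : n %% 4 < 4 by rewrite ltn_mod.
have blocks t := @extremal_rel_blocks k (4 * k + t) (leq_addr _ _).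
have recr s t : \sum_(i < 4 * k + s.+1) extremal_rel i (4 * k + t) =
    \sum_(i < 4 * k + s) extremal_rel i (4 * k + t) + extremal_rel s t.
  by rewrite addnS big_ord_recr /= extremal_rel_shift.
case: (n %% 4) => [|[|[|[|]]]] // _.
- by have := blocks 0; rewrite !addn0 => ->; rewrite -(addn1 (4 * k)) !turan_valueE; clear; lia.
- by rewrite recr addn0 blocks -addnS /extremal_rel /= !turan_valueE; clear; lia.
- by rewrite !recr addn0 blocks -addnS /extremal_rel /= !turan_valueE; clear; lia.
- rewrite !recr addn0 blocks -addnS /extremal_rel /= (_ : 4 * k + 4 = 4 * k.+1); last by clear; lia.
  by rewrite !turan_valueE; clear; lia.
Qed.

Lemma sum_extremal_rel n :
  \sum_(i < n) \sum_(j < n) extremal_rel i j = 2 * turan_value n.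
Proof.
elim: n => [|n IHn]; first by rewrite big_ord0.
rewrite big_ord_recr /= [X in _ + X]big_ord_recr /= extremal_rel_irr addn0.
under eq_bigr do rewrite big_ord_recr /=.
have -> : \sum_(i < n) extremal_rel n i = \sum_(i < n) extremal_rel i n.
  by apply: eq_bigr => i _; rewrite extremal_rel_sym.
by rewrite big_split /= IHn -extremal_rel_degree -addnA addnn -mul2n mulnDr.
Qed.

(* For n = 2 modulo 4 both divisions are exact and the subtraction is not
   truncated. *)
Theorem theorem5 (n : nat) (n_gt0 : 0 < n) (n_neq5 : n <> 5) :
  extremal_number n flattened_tetrahedron =
    if n %% 4 == 2 then n ^ 2 %/ 4 + n %/ 2 - 1 else n ^ 2 %/ 4 + n %/ 2.
Proof.
rewrite -/(turan_value n); apply/eqP; rewrite eqn_leq; apply/andP; split.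
  apply/bigmax_leqP => E /andP[simpleE /(T_free_adjacent simpleE) freeE].
  have := @T_free_edges _ _ (@adjacent_sym _ E) (adjacent_irr simpleE) freeE setT.
  by rewrite cardsT card_ord edges_adjacent // leq_pmul2l //; apply; apply/eqP.
pose r : rel 'I_n := fun i j => extremal_rel i j.
have r_sym : symmetric r by move=> i j; apply: extremal_rel_sym.
have r_irr : irreflexive r by move=> i; apply: extremal_rel_irr.
have simpleE := simple_edge_set r_irr.
have freeE : ~~ contains_copy (edge_set r) flattened_tetrahedron.
  apply/(T_free_adjacent simpleE) => b c e a d f.
  rewrite !(adjacent_edge_set r_sym).
  apply: (@T_free_bicolored _ _ r_sym r_irr (fun i => odd i./2)) => x y z.
  by move=> rxy rxz cy cz; apply/val_inj; apply: extremal_rel_matching rxy rxz cy cz.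
suff -> : turan_value n = #|edge_set r|.
  by apply: leq_bigmax_cond; rewrite simpleE.
apply/eqP; rewrite -(@eqn_pmul2l 2) // -edges_adjacent // -sum_extremal_rel.
rewrite /edges /deg; apply/eqP/esym.
under eq_bigl do rewrite inE.
apply: eq_bigr => i _; under eq_bigl do rewrite inE.
by apply: eq_bigr => j _; rewrite (adjacent_edge_set r_sym).
Qed.
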